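(* Let $p$ be an odd prime and let $G$ be a finite $p$-group of maximal class of order $p^n$ with $4 \leq n \leq p+1$ and of exponent $p^2$. Then for all $2 \leq i \leq n-1$, the subgroups $[P_i(G), G^{\varphi}]$ and $[P_i(G)^{\varphi}, G]$ of $\nu(G)$ are equal, and $\mathrm{exp}([P_i(G), G^{\varphi}]) \leq p$.
   Context: A finite $p$-group of order $p^n$ is of maximal class if its nilpotency class is $n-1$. Conventions: $x^y = y^{-1}xy$ and $[x,y] = x^{-1}y^{-1}xy$. For a group $G$, let $G^{\varphi}$ be an isomorphic copy of $G$ via an isomorphism $\varphi : G \to G^{\varphi}$, $g \mapsto g^{\varphi}$. The group $\nu(G)$ is the quotient $(G \ast G^{\varphi})/\mathcal{N}$ of the free product, where $\mathcal{N}$ is the normal subgroup generated by the relations $[g_1, g_2^{\varphi}]^{g_3} = [g_1^{g_3}, (g_2^{g_3})^{\varphi}] = [g_1, g_2^{\varphi}]^{g_3^{\varphi}}$ for all $g_1, g_2, g_3 \in G$. Elements of $G$ and $G^{\varphi}$ are identified with their images in $\nu(G)$. For subgroups $H, K \leq G$, $[H, K^{\varphi}]$ denotes the subgroup of $\nu(G)$ generated by all $[a, b^{\varphi}]$ with $a \in H$, $b \in K$; similarly $[H^{\varphi}, K]$ is the subgroup generated by all $[a^{\varphi}, b]$ with $a \in H$, $b \in K$. Set $P_2(G) = [G,G]$ and $P_i(G) = [P_{i-1}(G), G]$ for $3 \leq i \leq n-1$. $\mathrm{exp}(H)$ denotes the exponent of a group $H$. *)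

(* Defs.v *)
From HB Require Import structures.
From mathcomp Require Import all_boot.
From mathcomp Require Import boolp classical_sets.

Set Implicit Arguments.
Unset Strict Implicit.
Unset Printing Implicit Defensive.

Local Open Scope quotient_scope.
Local Open Scope classical_set_scope.
Local Open Scope group_scope.

Definition is_subgroup (T : groupType) (H : set T) : Prop :=
  [/\ H 1, {in H &, forall x y, H (x * y)} & {in H, forall x, H x^-1}].

Definition is_normal_subgroup (T : groupType) (N : set T) : Prop :=
  is_subgroup N /\ {in N, forall x y, N (x ^ y)}.

Definition generated (T : groupType) (S : set T) : set T :=
  smallest (@is_subgroup T) S.

Definition normal_closure (T : groupType) (S : set T) : set T :=
  smallest (@is_normal_subgroup T) S.

Definition commutator_subgroup (T : groupType) (A B : set T) : set T :=
  generated [set [~ a, b] | a in A & b in B].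

(* No such e exists when H has infinite exponent. *)
Definition has_exponent (T : groupType) (H : set T) (e : nat) : Prop :=
  [/\ 0 < e, {in H, forall h, h ^+ e = 1} &
      forall m, 0 < m -> {in H, forall h, h ^+ m = 1} -> e <= m].

Section NormalClosure.
Variables (T : groupType) (S : set T).
Local Notation N := (normal_closure S).

Lemma normal_closure1 : N 1.
Proof. by move=> M [[[M1 _ _] _] _]. Qed.

Lemma normal_closureM x y : N x -> N y -> N (x * y).
Proof.
move=> Nx Ny M MS; have [[[_ MM _] _] _] := MS.
by apply: MM; rewrite inE; [apply: Nx | apply: Ny].
Qed.

Lemma normal_closureV x : N x -> N x^-1.
Proof.
move=> Nx M MS; have [[[_ _ MV] _] _] := MS.
by apply: MV; rewrite inE; apply: Nx.
Qed.

Lemma normal_closureJ x y : N x -> N (x ^ y).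
Proof.
move=> Nx M MS; have [[_ MJ] _] := MS.
by apply: MJ; rewrite inE; apply: Nx.
Qed.

Definition ncl_rel : rel T := fun x y => `[< N (x^-1 * y) >].

Lemma ncl_rel_refl : reflexive ncl_rel.
Proof. by move=> x; apply/asboolP; rewrite mulVg; exact: normal_closure1. Qed.

Lemma ncl_rel_sym : symmetric ncl_rel.
Proof.
by move=> x y; apply/asboolP/asboolP => /normal_closureV; rewrite invgM invgK.
Qed.

Lemma ncl_rel_trans : transitive ncl_rel.
Proof.
move=> y x z /asboolP xy /asboolP yz; apply/asboolP.
by have := normal_closureM xy yz; rewrite -mulgA mulVKg.
Qed.

Canonical ncl_equiv := EquivRel ncl_rel ncl_rel_refl ncl_rel_sym ncl_rel_trans.

Definition quo := {eq_quot ncl_equiv}.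
HB.instance Definition _ := EqQuotient.on quo.
HB.instance Definition _ := Choice.on quo.

Lemma quoP x y : \pi_quo x = \pi_quo y <-> N (x^-1 * y).
Proof. by split=> [/eqquotP/asboolP | h]; last exact/eqquotP/asboolP. Qed.

Definition quo_one : quo := \pi_quo 1.
Definition quo_mul (x y : quo) : quo := \pi_quo (repr x * repr y).
Definition quo_inv (x : quo) : quo := \pi_quo (repr x)^-1.

Lemma quo_mulE x y : quo_mul (\pi_quo x) (\pi_quo y) = \pi_quo (x * y).
Proof.
rewrite /quo_mul; case: piP => x' /quoP xx'; case: piP => y' /quoP yy'.
apply/esym/quoP; have := normal_closureM (normal_closureJ y xx') yy'.
by rewrite /conjg invgM -!mulgA mulVKg.
Qed.

Lemma quo_invE x : quo_inv (\pi_quo x) = \pi_quo x^-1.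
Proof.
rewrite /quo_inv; case: piP => x' /quoP xx'; apply/quoP; rewrite invgK.
have := normal_closureJ x^-1 xx'.
by rewrite /conjg invgK -!mulgA mulVKg.
Qed.

Lemma quo_mulA : associative quo_mul.
Proof.
move=> x y z; rewrite -[x]reprK -[y]reprK -[z]reprK.
rewrite (quo_mulE (repr x) (repr y)) (quo_mulE (repr y) (repr z)).
by rewrite (quo_mulE _ (repr z)) (quo_mulE (repr x)) mulgA.
Qed.

Lemma quo_mul1 : left_id quo_one quo_mul.
Proof. by move=> x; rewrite -[x]reprK quo_mulE mul1g. Qed.

Lemma quo_mulr1 : right_id quo_one quo_mul.
Proof. by move=> x; rewrite -[x]reprK quo_mulE mulg1. Qed.

Lemma quo_mulV : left_inverse quo_one quo_inv quo_mul.
Proof. by move=> x; rewrite -[x]reprK quo_invE quo_mulE mulVg. Qed.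

Lemma quo_mulrV : right_inverse quo_one quo_inv quo_mul.
Proof. by move=> x; rewrite -[x]reprK quo_invE quo_mulE mulgV. Qed.

HB.instance Definition _ :=
  isGroup.Build quo quo_mulA quo_mul1 quo_mulr1 quo_mulV quo_mulrV.

End NormalClosure.

Section FreeProduct.
Variables A B : groupType.

(* The least congruence on words in the letters of A and B that multiplies
   adjacent letters of the same factor and erases the identity letters. *)
Inductive word_eq : seq (A + B) -> seq (A + B) -> Prop :=
| word_eq_refl u : word_eq u u
| word_eq_sym u v : word_eq u v -> word_eq v u
| word_eq_trans v u w : word_eq u v -> word_eq v w -> word_eq u w
| word_eq_cat u u' v v' :
    word_eq u u' -> word_eq v v' -> word_eq (u ++ v) (u' ++ v')
| word_eq_1l : word_eq [:: inl 1] [::]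
| word_eq_1r : word_eq [:: inr 1] [::]
| word_eq_Ml (a b : A) : word_eq [:: inl a; inl b] [:: inl (a * b)]
| word_eq_Mr (a b : B) : word_eq [:: inr a; inr b] [:: inr (a * b)].

Definition word_rel : rel (seq (A + B)) := fun u v => `[< word_eq u v >].

Lemma word_rel_refl : reflexive word_rel.
Proof. by move=> u; apply/asboolP/word_eq_refl. Qed.

Lemma word_rel_sym : symmetric word_rel.
Proof. by move=> u v; apply/asboolP/asboolP => /word_eq_sym. Qed.

Lemma word_rel_trans : transitive word_rel.
Proof.
by move=> v u w /asboolP uv /asboolP vw; apply/asboolP/(word_eq_trans uv vw).
Qed.

Canonical word_equiv :=
  EquivRel word_rel word_rel_refl word_rel_sym word_rel_trans.

Definition freeprod := {eq_quot word_equiv}.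
HB.instance Definition _ := EqQuotient.on freeprod.
HB.instance Definition _ := Choice.on freeprod.

Lemma freeprodP u v : \pi_freeprod u = \pi_freeprod v <-> word_eq u v.
Proof. by split=> [/eqquotP/asboolP | h]; last exact/eqquotP/asboolP. Qed.

Definition letter_inv (l : A + B) : A + B :=
  match l with inl a => inl a^-1 | inr b => inr b^-1 end.
Definition word_inv (u : seq (A + B)) := rev (map letter_inv u).

Lemma word_inv_eq u v : word_eq u v -> word_eq (word_inv u) (word_inv v).
Proof.
elim=> {u v}.
- by move=> u; apply: word_eq_refl.
- by move=> u v _; apply: word_eq_sym.
- by move=> v u w _ uv _; apply: word_eq_trans uv.
- move=> u u' v v' _ uu' _ vv'.
  by rewrite /word_inv !map_cat !rev_cat; apply: word_eq_cat.
- by rewrite /word_inv /= invg1; apply: word_eq_1l.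
- by rewrite /word_inv /= invg1; apply: word_eq_1r.
- by move=> a b; rewrite /word_inv /= invgM; apply: word_eq_Ml.
- by move=> a b; rewrite /word_inv /= invgM; apply: word_eq_Mr.
Qed.

Lemma word_invK : involutive word_inv.
Proof.
move=> u; rewrite /word_inv map_rev revK mapK //.
by case=> a /=; rewrite invgK.
Qed.

Lemma word_mulV u : word_eq (word_inv u ++ u) [::].
Proof.
elim: u => [|l u IHu]; first exact: word_eq_refl.
rewrite /word_inv /= rev_cons cat_rcons -cat1s -[_ :: u]cat1s [X in _ ++ X]catA.
apply: word_eq_trans IHu; apply: word_eq_cat; first exact: word_eq_refl.
rewrite -[X in word_eq _ X]cat0s; apply: word_eq_cat; last exact: word_eq_refl.
case: l => a /=.
  by apply: word_eq_trans (word_eq_Ml _ _) _; rewrite mulVg; apply: word_eq_1l.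
by apply: word_eq_trans (word_eq_Mr _ _) _; rewrite mulVg; apply: word_eq_1r.
Qed.

Definition freeprod_one : freeprod := \pi_freeprod [::].
Definition freeprod_mul (x y : freeprod) : freeprod :=
  \pi_freeprod (repr x ++ repr y).
Definition freeprod_inv (x : freeprod) : freeprod :=
  \pi_freeprod (word_inv (repr x)).

Lemma freeprod_mulE u v :
  freeprod_mul (\pi_freeprod u) (\pi_freeprod v) = \pi_freeprod (u ++ v).
Proof.
rewrite /freeprod_mul; case: piP => u' /freeprodP uu'.
case: piP => v' /freeprodP vv'.
by apply/esym/freeprodP/word_eq_cat.
Qed.

Lemma freeprod_invE u :
  freeprod_inv (\pi_freeprod u) = \pi_freeprod (word_inv u).
Proof.
rewrite /freeprod_inv; case: piP => u' /freeprodP uu'.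
by apply/esym/freeprodP/word_inv_eq.
Qed.

Lemma freeprod_mulA : associative freeprod_mul.
Proof.
move=> x y z; rewrite -[x]reprK -[y]reprK -[z]reprK.
rewrite (freeprod_mulE (repr x) (repr y)) (freeprod_mulE (repr y) (repr z)).
by rewrite (freeprod_mulE _ (repr z)) (freeprod_mulE (repr x)) catA.
Qed.

Lemma freeprod_mul1 : left_id freeprod_one freeprod_mul.
Proof. by move=> x; rewrite -[x]reprK freeprod_mulE. Qed.

Lemma freeprod_mulr1 : right_id freeprod_one freeprod_mul.
Proof. by move=> x; rewrite -[x]reprK freeprod_mulE cats0. Qed.

Lemma freeprod_mulV : left_inverse freeprod_one freeprod_inv freeprod_mul.
Proof.
move=> x; rewrite -[x]reprK freeprod_invE freeprod_mulE.
exact/freeprodP/word_mulV.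
Qed.

Lemma freeprod_mulrV : right_inverse freeprod_one freeprod_inv freeprod_mul.
Proof.
move=> x; rewrite -[x]reprK freeprod_invE freeprod_mulE; apply/freeprodP.
by rewrite -{1}(word_invK (repr x)); apply: word_mulV.
Qed.

HB.instance Definition _ := isGroup.Build freeprod
  freeprod_mulA freeprod_mul1 freeprod_mulr1 freeprod_mulV freeprod_mulrV.

Definition fp_inl (a : A) : freeprod := \pi_freeprod [:: inl a].
Definition fp_inr (b : B) : freeprod := \pi_freeprod [:: inr b].

End FreeProduct.

Arguments fp_inl {A B} a.
Arguments fp_inr {A B} b.

Section Nu.
Variable G : groupType.

(* The isomorphic copy of G is the right factor of [freeprod G G], so that
   g^phi is [fp_inr g]. A relation u = v is encoded by the relator u^-1 * v. *)
Definition nu_relators : set (freeprod G G) :=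
  [set r | exists g1 g2 g3 : G,
     r = ([~ fp_inl g1, fp_inr g2] ^ fp_inl g3)^-1
         * [~ fp_inl (g1 ^ g3), fp_inr (g2 ^ g3)]
  \/ r = [~ fp_inl (g1 ^ g3), fp_inr (g2 ^ g3)]^-1
         * [~ fp_inl g1, fp_inr g2] ^ fp_inr g3].

Definition nu := quo nu_relators.
HB.instance Definition _ := Group.on nu.

Definition nu_base (g : G) : nu := \pi_nu (fp_inl g).
Definition nu_phi (g : G) : nu := \pi_nu (fp_inr g).

(* [comm_phi_r H K] is [H, K^phi] and [comm_phi_l H K] is [H^phi, K]. *)
Definition comm_phi_r (H K : {pred G}) : set nu :=
  commutator_subgroup (nu_base @` [set` H]) (nu_phi @` [set` K]).

Definition comm_phi_l (H K : {pred G}) : set nu :=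
  commutator_subgroup (nu_phi @` [set` H]) (nu_base @` [set` K]).

End Nu.

Arguments nu_base {G} g.
Arguments nu_phi {G} g.

(* Main.v *)
From HB Require Import structures.
From mathcomp Require Import boolp classical_sets.
From mathcomp Require Import all_boot all_fingroup all_solvable zify.
Require Import Defs.

(** The exponent statement is a statement about regular groups. In [nu G], write
b g and f g for the images of g in the two factors. For x in G' the generator
[~ b x, f g] of [G', G^phi] equals (b x)^-1 * (b x) ^ f g, a product of two
conjugates of elements of b G'. Two facts therefore suffice: G' has exponent p
([maximal_class_der1]), and the normal closure of b G' in [nu G] has nilpotency
class less than p, because then it is regular and products of elements of order
p again have order p ([expgp_eq1_mul]). The second fact holds because [nu G]
has class at most p + 1 when G has class at most p ([nu_chain_trivial]), while
b G' lies in the second term of the lower central series. All subgroups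
[L_i(G), G^phi] with 1 < i are contained in [G', G^phi].

The regularity theory is developed for an arbitrary group T and an arbitrary
[filtration] A, a decreasing sequence of subgroups such that the commutator of
A i and A j lies in A (i + j). The sequences k |-> f k in T whose r-th iterated
derivatives lie in A (i + r) form again a filtration, on the group of all
sequences ([polyseq_filtration], due to Leibman). Taylor expansion of
k |-> y ^- k * x ^- k * (x * y) ^+ k in binomial coefficients then shows
(x * y) ^+ p = x ^+ p * y ^+ p when A 2 has exponent p and A p is trivial
([filt_expgM]). An induction on the length of the filtration removes the
assumption on A 2 as soon as x ^+ p and y ^+ p are central ([prime_regular]).
A useful by-product is that [~ x, g] ^+ p = 1 when x ^+ p is central and
A p.+1 is trivial ([regular_commg]): x^-1 and x ^ g lie in the bicentralizer of
x modulo A 3, and this subgroup has a filtration that is shorter by one.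

For G of maximal class, induction on the order applies to the quotient by the
centre Z, which has order p. By regularity the p-th power map is a homomorphism
on G / Z, and its image lies in the centre of G / Z, which has order p as well
unless G has order at most p^3, in which case G' is contained in Z.
So the elements h of G with h ^+ p in Z form a subgroup of index at most p, and
they satisfy [~ h, g] ^+ p = 1; every other commutator reduces to these, because
modulo that subgroup G is generated by any element outside of it.

The equality of [L_i(G), G^phi] and [L_i(G)^phi, G] comes from the identity
[~ b x, f g] = [~ f x, b g] for x in G'. For commutators x it is a consequence
of the defining relations, which say that b z and f z conjugate the elements
[~ b x, f y] in the same way ([compat_comm_swap]), and it passes to products. *)

Set Implicit Arguments.
Unset Strict Implicit.
Unset Printing Implicit Defensive.

Local Open Scope group_scope.

(** * Commutator identities in arbitrary groups *)

Section Identities.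
Variable T : groupType.
Implicit Types x y z : T.

Lemma gconjg_mulR x y : x ^ y = x * [~ x, y].
Proof. by rewrite commgEl mulKVg. Qed.

Lemma gcommMgJ x y z : [~ x * y, z] = [~ x, z] ^ y * [~ y, z].
Proof. by rewrite !commgEr conjgM mulgA -conjMg mulgK. Qed.

Lemma gcommgMJ x y z : [~ x, y * z] = [~ x, z] * [~ x, y] ^ z.
Proof. by rewrite !commgEl conjgM -mulgA -conjMg mulKVg. Qed.

Lemma gcommVg x y : [~ x^-1, y] = ([~ x, y]^-1) ^ x^-1.
Proof.
apply/eqP; rewrite -(can_eq (mulKg ([~ x, y] ^ x^-1))) conjVg mulgV.
by rewrite -gcommMgJ mulgV comm1g.
Qed.

Lemma gHall_Witt x y z :
  [~ x, y^-1, z] ^ y * [~ y, z^-1, x] ^ z * [~ z, x^-1, y] ^ x = 1.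
Proof.
pose a x y z : T := x * z * y ^ x.
suffices hw_aux (u v w : T) : [~ u, v^-1, w] ^ v = (a u v w)^-1 * (a v w u).
  by rewrite !hw_aux; move: a {hw_aux} => a; rewrite 2!mulgA !mulgK mulVg.
have conj_Rmul (s t : T) : s ^ t = [~ t, s^-1] * s.
  by rewrite commgEr invgK -mulgA mulVg mulg1.
by rewrite commgEr conjMg -conjgM -conj_Rmul conjgE !invgM !mulgA.
Qed.

End Identities.

(** * Filtered groups *)

Record filtration (T : groupType) (A : nat -> set T) : Prop := Filtration {
  filt1 : forall i, A i 1;
  filtM : forall i x y, A i x -> A i y -> A i (x * y);
  filtV : forall i x, A i x -> A i x^-1;
  filtS : forall i x, A i.+1 x -> A i x;
  filtR : forall i j x y, A i x -> A j y -> A (i + j) [~ x, y] }.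

Section Filtration.
Variables (T : groupType) (A : nat -> set T).
Hypothesis fA : filtration A.

Lemma filt_leq i j x : i <= j -> A j x -> A i x.
Proof.
move/subnKC <-; elim: (j - i) => [|k IHk]; first by rewrite addn0.
by rewrite addnS => /(filtS fA).
Qed.

Lemma filt0 i x : A i x -> A 0 x.
Proof. exact: filt_leq. Qed.

Lemma filtJ i j x y : A i x -> A j y -> A i (x ^ y).
Proof.
move=> Ax Ay; rewrite gconjg_mulR; apply: (filtM fA) => //.
by apply: filt_leq (filtR fA Ax Ay); exact: leq_addr.
Qed.

Lemma filtX i x n : A i x -> A i (x ^+ n).
Proof.
move=> Ax; elim: n => [|n IHn]; first by rewrite expg0; apply: filt1.
by rewrite expgS; apply: filtM.
Qed.

(** Modulo A (i + j).+1 the commutator of A i and A j depends only on the classes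
of its arguments modulo A i.+1 and A j.+1. This is the product rule that makes
the derivative of a commutator of polynomial sequences one step deeper. *)
Lemma filt_comm_shift i j f g u v :
    A i f -> A i.+1 u -> A j g -> A j.+1 v ->
  A (i + j).+1 ([~ f, g]^-1 * [~ f * u, g * v]).
Proof.
move=> Af Au Ag Av; pose q := [~ f, g].
have Aq : A (i + j) q by apply: filtR.
have A0q := filt0 Aq; have A0u := filt0 Au; have A0v := filt0 Av.
have Afuv : A (i + j).+1 [~ f * u, v].
  rewrite -addnS; apply: (filtR fA) => //.
  by apply: (filtM fA) => //; apply: filtS.
have Aug : A (i + j).+1 [~ u, g] by rewrite -addSn; apply: filtR.
have Aquv : A (i + j).+1 [~ q, u * v].
  rewrite gcommgMJ; apply: (filtM fA); last apply: (filtJ _ Av).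
    by apply: filt_leq (filtR fA Aq Av); rewrite addnS ltnS leq_addr.
  by apply: filt_leq (filtR fA Aq Au); rewrite addnS ltnS leq_addr.
have -> : [~ f, g]^-1 * [~ f * u, g * v]
        = [~ f * u, v] ^ q * ([~ q, u * v] * [~ u, g] ^ v).
  rewrite gcommgMJ [ [~ f * u, g] ]gcommMgJ conjMg -conjgM -/q.
  rewrite [q ^ (u * v)]gconjg_mulR.
  by rewrite [_ ^ q]conjgE !mulgA mulgK.
apply: (filtM fA); first exact: (filtJ _ Aq).
by apply: (filtM fA) => //; exact: (filtJ _ Av).
Qed.

End Filtration.

(** * Polynomial sequences *)

Definition sequence (T : Type) := nat -> T.
HB.instance Definition _ (T : choiceType) := Choice.on (sequence T).

Section PolynomialSequences.
Variable T : groupType.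

Definition sequence_one : sequence T := fun _ => 1.
Definition sequence_mul (f g : sequence T) : sequence T := fun k => f k * g k.
Definition sequence_inv (f : sequence T) : sequence T := fun k => (f k)^-1.

Lemma sequence_mulA : associative sequence_mul.
Proof. by move=> f g h; apply/funext => k; exact: mulgA. Qed.
Lemma sequence_mul1 : left_id sequence_one sequence_mul.
Proof. by move=> f; apply/funext => k; exact: mul1g. Qed.
Lemma sequence_mulr1 : right_id sequence_one sequence_mul.
Proof. by move=> f; apply/funext => k; exact: mulg1. Qed.
Lemma sequence_mulV : left_inverse sequence_one sequence_inv sequence_mul.
Proof. by move=> f; apply/funext => k; exact: mulVg. Qed.
Lemma sequence_mulrV : right_inverse sequence_one sequence_inv sequence_mul.
Proof. by move=> f; apply/funext => k; exact: mulgV. Qed.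

HB.instance Definition _ := isGroup.Build (sequence T)
  sequence_mulA sequence_mul1 sequence_mulr1 sequence_mulV sequence_mulrV.

Definition shift (f : sequence T) : sequence T := fun k => f k.+1.
Definition deriv (f : sequence T) : sequence T := f^-1 * shift f.

Lemma shiftE f : shift f = f * deriv f.
Proof. by rewrite /deriv mulKVg. Qed.

Lemma derivE f k : deriv f k = (f k)^-1 * f k.+1.
Proof. by []. Qed.

Lemma deriv1 : deriv 1 = 1.
Proof. by apply/funext => k; exact: mulVg. Qed.

Lemma derivM f g : deriv (f * g) = deriv f ^ g * deriv g.
Proof.
have -> : deriv (f * g) = (f * g)^-1 * (shift f * shift g) by [].
by rewrite !shiftE invgM conjgE !mulgA !mulgKV.
Qed.

Lemma derivV f : deriv f^-1 = (deriv f)^-1 ^ f^-1.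
Proof.
have -> : deriv f^-1 = f * (shift f)^-1 by rewrite /deriv invgK.
by rewrite shiftE invgM conjgE invgK.
Qed.

Lemma derivR f g :
  deriv [~ f, g] = [~ f, g]^-1 * [~ f * deriv f, g * deriv g].
Proof. by rewrite -!shiftE. Qed.

Variable A : nat -> set T.
Hypothesis fA : filtration A.

(** Only r derivatives are controlled. The truncation is what lets
[polyseq_filtration] go by induction: the step from r to r.+1 applies the
statement for r to sequences and to their derivatives, without assuming that
T is nilpotent. *)
Fixpoint polyseq r i (f : sequence T) : Prop :=
  (forall k, A i (f k)) /\
  (if r is r'.+1 then polyseq r' i.+1 (deriv f) else True).

Lemma polyseqS r i f : polyseq r.+1 i f -> polyseq r i f.
Proof.
elim: r i f => [|r IHr] i f [Af Pf] //; split=> //; exact: IHr.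
Qed.

(** Derivatives of products, inverses and commutators are products of conjugates
and commutators of sequences that are already known to be polynomial; the
commutator case is [filt_comm_shift] in the group of sequences. *)
Lemma polyseq_filtration r : filtration (polyseq r).
Proof.
elim: r => [|r fP].
  split=> [i|i f g|i f|i f|i j f g]; rewrite /=.
  - by split=> // k; exact: filt1.
  - by case=> Af _ [Ag _]; split=> // k; exact: filtM.
  - by case=> Af _; split=> // k; exact: filtV.
  - by case=> Af _; split=> // k; exact: filtS.
  - by case=> Af _ [Ag _]; split=> // k; exact: filtR.
split=> [i|i f g Pf Pg|i f Pf|i f|i j f g Pf Pg].
- by split; [move=> k; exact: filt1 | rewrite deriv1; exact: filt1].
- have [[Af Pdf] [Ag Pdg]] := (Pf, Pg); split; first by move=> k; exact: filtM.
  rewrite -/polyseq derivM; apply: (filtM fP) => //.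
  exact: filtJ (polyseqS Pg).
- have [Af Pdf] := Pf; split; first by move=> k; exact: filtV.
  rewrite -/polyseq derivV; apply: (filtJ fP (filtV fP Pdf)).
  exact: filtV (polyseqS Pf).
- case=> Af Pdf; split; first by move=> k; exact: filtS.
  exact: (filtS fP).
have [[Af Pdf] [Ag Pdg]] := (Pf, Pg); split; first by move=> k; exact: filtR.
by rewrite -/polyseq derivR; apply: filt_comm_shift => //; exact: polyseqS.
Qed.

(** By Pascal's rule the derivative replaces j by j - 1, so the weight i + j of
the coefficient is preserved while i increases. *)
Lemma polyseq_binomial r i j c :
  A (i + j) c -> polyseq r i (fun k => c ^+ 'C(k, j)).
Proof.
have AX i' j' k : A (i' + j') c -> A i' (c ^+ 'C(k, j')).
  by move=> Ac; apply: filtX => //; apply: filt_leq Ac => //; exact: leq_addr.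
elim: r i j => [|r IHr] i j Ac; (split; first by move=> k; exact: AX) => //.
case: j Ac => [|j] Ac.
  rewrite (_ : deriv _ = 1); first exact: filt1 (polyseq_filtration r) _.
  by apply/funext=> k; rewrite derivE !bin0 mulVg.
rewrite (_ : deriv _ = fun k => c ^+ 'C(k, j)).
  by apply: IHr; rewrite addSnnS.
by apply/funext=> k; rewrite derivE binS expgnDr mulKg.
Qed.

(** The first non-trivial value of a sequence is its iterated derivative at 0. *)
Lemma polyseq_first r i f :
  polyseq r i f -> (forall k, k < r -> f k = 1) -> A (i + r) (f r).
Proof.
elim: r i f => [|r IHr] i f [Af Pf] f0; first by rewrite addn0.
have -> : f r.+1 = deriv f r by rewrite derivE (f0 r) // invg1 mul1g.
rewrite addnS -addSn; apply: IHr => // k ltkr.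
by rewrite derivE !f0 ?mulVg // leqW.
Qed.

Lemma polyseq_le r s i f : r <= s -> polyseq s i f -> polyseq r i f.
Proof.
move/subnKC <-; elim: (s - r) => [|k IHk]; first by rewrite addn0.
by rewrite addnS => /polyseqS.
Qed.

(** Dividing successively by c_m ^+ 'C(k, m) kills the values at m = 2, ..., p - 1
without changing the value at p: c_m lies in A 2 and p divides 'C(p, m). The
value at p is then a first non-trivial value, hence lies in A p. *)
Lemma polyseq_prime_vanish p f : prime p ->
  (forall z, A 2 z -> z ^+ p = 1) -> (forall z, A p z -> z = 1) ->
  polyseq p 0 f -> f 0 = 1 -> f 1%N = 1 -> f p = 1.
Proof.
move=> p_pr A2p Ap1 Pf f0 f1.
suff [g [Pg g0 gp]] : exists g, [/\ polyseq p 0 g,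
    (forall k, k < p -> g k = 1) & g p = f p].
  by rewrite -gp; apply: Ap1; have := polyseq_first Pg g0.
have p_gt1 := prime_gt1 p_pr.
suff IH m : 2 <= m -> m <= p -> exists g, [/\ polyseq p 0 g,
    (forall k, k < m -> g k = 1) & g p = f p] by exact: IH.
elim: m => // m IHm; rewrite ltnS leq_eqVlt => /orP[/eqP <- _|m_gt1 ltmp].
  by exists f; split=> // [] [|[]].
have [g [Pg g0 gp]] := IHm m_gt1 (ltnW ltmp).
have Agm : A m (g m) by have := polyseq_first (polyseq_le (ltnW ltmp) Pg) g0.
have fP := polyseq_filtration p.
pose h : sequence T := fun k => g m ^+ 'C(k, m).
exists (h^-1 * g); split.
- by apply: (filtM fP) => //; apply: (filtV fP); exact: polyseq_binomial.
- move=> k; rewrite ltnS leq_eqVlt => /orP[/eqP->|ltkm].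
    by change ((g m ^+ 'C(m, m))^-1 * g m = 1); rewrite binn mulVg.
  change ((g m ^+ 'C(k, m))^-1 * g k = 1).
  by rewrite bin_small // expg0 g0 // invg1 mul1g.
change ((g m ^+ 'C(p, m))^-1 * g p = f p).
have /dvdnP[b ->] : p %| 'C(p, m) by apply: prime_dvd_bin => //; rewrite ltnW.
rewrite mulnC expgnA A2p; first by rewrite expg1n invg1 mul1g.
exact: (filt_leq fA m_gt1).
Qed.

(** The sequence k |-> (x ^+ k * y ^+ k)^-1 * (x * y) ^+ k is polynomial and
vanishes at 0 and 1, hence at p. *)
Lemma filt_expgM p x y : prime p ->
  (forall z, A 2 z -> z ^+ p = 1) -> (forall z, A p z -> z = 1) ->
  A 1 x -> A 1 y -> (x * y) ^+ p = x ^+ p * y ^+ p.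
Proof.
move=> p_pr A2p Ap1 Ax Ay.
have fP := polyseq_filtration p.
have PX z : A 1 z -> polyseq p 0 (fun k => z ^+ k).
  move=> Az; rewrite (_ : (fun k => _) = (fun k => z ^+ 'C(k, 1))).
    exact: polyseq_binomial.
  by apply/funext=> k; rewrite bin1.
pose xs : sequence T := fun k => x ^+ k.
pose ys : sequence T := fun k => y ^+ k.
pose f := xs * ys.
pose g : sequence T := fun k => (x * y) ^+ k.
have Pf : polyseq p 0 (f ^-1 * g).
  apply: (filtM fP); last by apply: PX; exact: filtM.
  by apply: (filtV fP); apply: (filtM fP); exact: PX.
have /(polyseq_prime_vanish p_pr A2p Ap1 Pf) : (f ^-1 * g) 0 = 1.
  by change ((x ^+ 0 * y ^+ 0)^-1 * (x * y) ^+ 0 = 1); rewrite !expg0 mul1g mulVg.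
have f1 : (f ^-1 * g) 1%N = 1.
  by change ((x ^+ 1 * y ^+ 1)^-1 * (x * y) ^+ 1 = 1); rewrite !expg1 mulVg.
move/(_ f1) => fp; apply: (mulgI (x ^+ p * y ^+ p)^-1).
by rewrite mulVg; exact: fp.
Qed.
End PolynomialSequences.

(** * Regularity *)

Section Regularity.
Variable T : groupType.
Implicit Types (A B : nat -> set T) (x y z : T).

(** This serves to put given elements in degree 1 over a well-behaved subgroup in
degree 2: D need not be comparable with B 1. *)
Lemma filtration_head B (D : set T) :
    filtration B -> D 1 -> (forall x y, D x -> D y -> D (x * y)) ->
    (forall x, D x -> D x^-1) -> (forall x, B 2 x -> D x) ->
    (forall x y, D x -> D y -> B 2 [~ x, y]) ->
    (forall j x y, D x -> B j y -> B j.+1 [~ x, y]) ->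
  filtration (fun k => if k <= 1 then D else B k).
Proof.
move=> fB D1 DM DV BD DR DBR; split.
- by move=> i; case: ifP => // _; exact: filt1.
- by move=> i x y; case: ifP => _; [exact: DM | exact: filtM].
- by move=> i x; case: ifP => _; [exact: DV | exact: filtV].
- by move=> [|[|i]] x //=; [exact: BD | exact: filtS].
have B2 k z : k <= 2 -> B 2 z -> (if k <= 1 then D else B k) z.
  by case: k => [|[|[|]]] //= _; exact: BD.
move=> i j x y; have [i_le1 Dx|i_gt1 Bx] := leqP i 1%N;
  have [j_le1 Dy|j_gt1 By] := leqP j 1%N.
- by apply: B2 (DR _ _ Dx Dy); rewrite (leq_add i_le1 j_le1).
- rewrite leqNgt (leq_trans j_gt1) ?leq_addl //=.
  by apply: (filt_leq fB) (DBR _ _ _ Dx By); rewrite -add1n leq_add2r.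
- rewrite leqNgt (leq_trans i_gt1) ?leq_addr //= -invgR.
  apply: (filtV fB).
  by apply: (filt_leq fB) (DBR _ _ _ Dy Bx); rewrite -addn1 leq_add2l.
by rewrite leqNgt (leq_trans i_gt1) ?leq_addr //=; exact: filtR.
Qed.

Lemma filtration_shift A : filtration A -> filtration (fun k => A k.+1).
Proof.
move=> fA; split=> [i|i x y|i x|i x|i j x y Ax Ay].
- exact: filt1.
- exact: filtM.
- exact: filtV.
- exact: filtS.
by apply: (filt_leq fA) (filtR fA Ax Ay); rewrite addSn ltnS addnS leqW.
Qed.

(** The double centralizer of x modulo A 3: it contains x and A 2, and it is
abelian modulo A 3. It plays the role of the subgroup generated by x and A 2, with
closure properties that need no normal form for its elements. *)
Definition bicentralizer A x : set T := fun z =>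
  A 1%N z /\ forall h, A 1%N h -> A 3 [~ x, h] -> A 3 [~ z, h].

Lemma bicentralizer_filtration A x : filtration A -> A 1%N x ->
  filtration (fun k => if k <= 1 then bicentralizer A x else A k.+1).
Proof.
move=> fA A1x; apply: (filtration_head (filtration_shift fA)).
- split=> [|h _ _]; first exact: filt1.
  by rewrite comm1g; exact: filt1.
- move=> y z [A1y Cy] [A1z Cz]; split=> [|h Ah Axh]; first exact: filtM.
  rewrite gcommMgJ; apply: (filtM fA); last exact: Cz.
  by apply: (filtJ fA _ A1z); exact: Cy.
- move=> y [A1y Cy]; split=> [|h Ah Axh]; first exact: filtV.
  rewrite gcommVg; apply: (filtJ fA _ (filtV fA A1y)).
  by apply: (filtV fA); exact: Cy.
- move=> y A3y; split=> [|h Ah _]; first exact: (filt_leq fA _ A3y).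
  exact: filtS (filtR fA A3y Ah).
- move=> y z [A1y Cy] [A1z Cz]; apply: Cy => //; rewrite -invgR.
  by apply: filtV => //; apply: Cz => //; rewrite commgg; exact: filt1.
by move=> j y z [A1y _] /(filtR fA A1y); rewrite add1n.
Qed.

(** Allowing central p-th powers instead of trivial ones is needed for maximal
class, where p-th powers are only known to be central. *)
Definition regular_of_length p c := forall A x y,
  filtration A -> (forall z, A c z -> z = 1) -> A 1%N x -> A 1%N y ->
  (forall h, A 1%N h -> commute (x ^+ p) h) ->
  (forall h, A 1%N h -> commute (y ^+ p) h) ->
  (x * y) ^+ p = x ^+ p * y ^+ p.

(** [~ x, g] is the product of x^-1 and x ^ g, whose p-th powers cancel, and both
lie in the bicentralizer of x, which starts a filtration of length c. *)
Lemma regular_commg p c A x g : regular_of_length p c -> 1 < c ->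
    filtration A -> (forall z, A c.+1 z -> z = 1) -> A 1%N x -> A 1%N g ->
  (forall h, A 1%N h -> commute (x ^+ p) h) -> [~ x, g] ^+ p = 1.
Proof.
move=> reg_c c_gt1 fA Ac1 Ax Ag Zxp.
have xgp : (x ^ g) ^+ p = x ^+ p by rewrite -conjXg conjgE Zxp // mulKg.
have fF := bicentralizer_filtration fA Ax.
have Fx : bicentralizer A x x by [].
have Fxg : bicentralizer A x (x ^ g).
  rewrite gconjg_mulR; apply: (filtM fF (i := 1%N)) => //=.
  have A2 : A 2 [~ x, g] by exact: (filtR fA Ax Ag).
  split=> [|h Ah _]; [exact: filtS | exact: (filtR fA A2 Ah)].
rewrite commgEl (reg_c _ _ _ fF) //=.
- by rewrite xgp expVgn mulVg.
- by rewrite leqNgt c_gt1.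
- exact: (filtV fF (i := 1%N)).
- by move=> h [Ah _]; rewrite expVgn; apply/commute_sym/commuteV/commute_sym/Zxp.
by move=> h [Ah _]; rewrite xgp; exact: Zxp.
Qed.

(** Induction on the length c. By [regular_commg] the elements x and y belong to
the group D of all z with [~ z, w] ^+ p = 1 for every w. By induction the
elements z of A 2 with z ^+ p = 1 form a subgroup; intersecting it with the A k
and putting D on top gives a filtration to which [filt_expgM] applies. *)
Lemma prime_regular p c : prime p -> c <= p -> regular_of_length p c.
Proof.
move=> p_pr; elim: c => [|c IHc] le_cp A x y fA Ac1 Ax Ay Zx Zy.
  have -> : x = 1 by apply: Ac1; exact: (filtS fA).
  have -> : y = 1 by apply: Ac1; exact: (filtS fA).
  by rewrite mulg1 expg1n mulg1.
have [c_le1|c_gt1] := leqP c 1%N.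
  apply: (filt_expgM fA) => // z Az; last exact/Ac1/(filt_leq fA _ Az).
  by rewrite (Ac1 z) ?expg1n //; exact: (filt_leq fA _ Az).
have reg_c := IHc (ltnW le_cp).
have A2M u v : A 2 u -> A 2 v -> u ^+ p = 1 -> v ^+ p = 1 -> (u * v) ^+ p = 1.
  move=> Au Av up vp.
  rewrite (reg_c _ _ _ (filtration_shift fA)) // ?up ?vp ?mulg1 // => h _.
    exact/commute_sym/commute1.
  exact/commute_sym/commute1.
have A2R u v : A 2 u -> A 0 v -> u ^+ p = 1 -> [~ u, v] ^+ p = 1.
  move=> Au Av up; rewrite commgEl A2M ?expVgn ?up ?invg1 //.
  - exact: filtV.
  - exact: (filtJ fA Au Av).
  by rewrite -conjXg up conj1g.
pose B k : set T := fun z => [/\ A k z, A 2 z & z ^+ p = 1].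
have fB : filtration B.
  split=> [i|i u v [Aiu Au up] [Aiv Av vp]|i u [Aiu Au up]|i u [Aiu Au up]|
            i j u v [Aiu Au up] [Ajv Av vp]]; split.
  - exact: filt1.
  - exact: filt1.
  - exact: expg1n.
  - exact: filtM.
  - exact: filtM.
  - exact: A2M.
  - exact: filtV.
  - exact: filtV.
  - by rewrite expVgn up invg1.
  - exact: filtS.
  - by [].
  - by [].
  - exact: filtR.
  - by apply: (filt_leq fA) (filtR fA Au Av).
  by apply: A2R => //; exact: filt0 Av.
pose D : set T := fun z => A 1%N z /\ forall w, A 1%N w -> [~ z, w] ^+ p = 1.
have fE : filtration (fun k => if k <= 1 then D else B k).
  apply: (filtration_head fB).
  - by split=> [|w _]; [exact: filt1 | rewrite comm1g expg1n].
  - move=> u v [Au Du] [Av Dv]; split=> [|w Aw]; first exact: filtM.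
    rewrite gcommMgJ A2M //; last 2 first.
    + by rewrite -conjXg Du // conj1g.
    + exact: Dv.
    + by apply: (filtJ fA _ Av); exact: (filtR fA Au Aw).
    exact: (filtR fA Av Aw).
  - move=> u [Au Du]; split=> [|w Aw]; first exact: filtV.
    by rewrite gcommVg -conjXg expVgn Du // invg1 conj1g.
  - move=> u [_ Au up]; split=> [|w Aw]; first exact: filtS.
    by apply: A2R => //; exact: filt0 Aw.
  - move=> u v [Au Du] [Av _]; split; last exact: Du.
      exact: (filtR fA Au Av).
    exact: (filtR fA Au Av).
  move=> j u v [Au Du] [Ajv Av vp]; split; last by apply: Du; exact: (filtS fA).
    exact: (filtR fA Au Ajv).
  exact: (filtS fA) (filtR fA Au Av).
have DA z : A 1%N z -> (forall h, A 1%N h -> commute (z ^+ p) h) -> D z.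
  move=> Az Zz; split=> // w Aw.
  exact: (regular_commg reg_c c_gt1 fA Ac1 Az Aw Zz).
apply: (filt_expgM fE) => //=.
- by move=> z [].
- move=> z; rewrite leqNgt (prime_gt1 p_pr) /= => -[Az _ _].
  exact/Ac1/(filt_leq fA _ Az).
- exact: DA.
exact: DA.
Qed.

(** The even-indexed terms of A form a filtration starting with A 2, whose length
is half that of A. *)
Lemma expgp_eq1_mul p (A : nat -> set T) x y : prime p -> filtration A ->
    (forall z, A p.*2 z -> z = 1) -> A 2 x -> A 2 y ->
  x ^+ p = 1 -> y ^+ p = 1 -> (x * y) ^+ p = 1.
Proof.
move=> p_pr fA A1 Ax Ay xp yp.
have fA2 : filtration (fun k => A k.*2).
  split=> [i|i u v|i u|i u|i j u v Au Av].
  - exact: filt1.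
  - exact: filtM.
  - exact: filtV.
  - by move/(filtS fA)/(filtS fA).
  by rewrite doubleD; exact: (filtR fA).
rewrite (prime_regular p_pr (leqnn p) fA2 A1 Ax Ay) ?xp ?yp ?mulg1 // => h _;
  exact/commute_sym/commute1.
Qed.

End Regularity.

(** * The filtration of a central chain *)

Section CentralChain.
Variable T : groupType.
Variable U : nat -> set T.
Hypothesis U1 : forall k, U k 1.
Hypothesis UM : forall k x y, U k x -> U k y -> U k (x * y).
Hypothesis UV : forall k x, U k x -> U k x^-1.
Hypothesis US : forall k x, U k.+1 x -> U k x.
Hypothesis U01 : forall x, U 0 x -> U 1%N x.
Hypothesis UR : forall k x y, U k x -> U 1%N y -> U k.+1 [~ x, y].

(** A central chain U need not satisfy the commutator condition of a filtration.
The elements of U k that raise degrees in U by k do, by the three subgroups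
lemma, and they exhaust U 1 when k = 1; so this serves as a lower central
series that is bounded by U. *)
Definition chain_filtration k : set T := fun z =>
  U k z /\ forall j u, U j u -> U (k + j) [~ z, u].

Let U_top k x : U k x -> U 1%N x.
Proof. by elim: k => [/U01 //|k IHk /US]. Qed.

Let UJ k x y : U k x -> U 1%N y -> U k (x ^ y).
Proof. by move=> Ux Uy; rewrite gconjg_mulR; apply: UM => //; apply/US/UR. Qed.

Lemma chain_filtration_top x : U 1%N x -> chain_filtration 1%N x.
Proof.
move=> Ux; split=> // j u Uu; rewrite add1n -invgR; apply: UV; exact: UR.
Qed.

Lemma chain_filtrationP : filtration chain_filtration.
Proof.
split=> [k|k x y [Ux Rx] [Uy Ry]|k x [Ux Rx]|k x [Ux Rx]|
         i j x y [Ux Rx] [Uy Ry]]; split.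
- exact: U1.
- by move=> j u _; rewrite comm1g; exact: U1.
- exact: UM.
- move=> j u Uu; rewrite gcommMgJ; apply: UM; last exact: Ry.
  by apply: UJ; [exact: Rx | exact: U_top Uy].
- exact: UV.
- move=> j u Uu; rewrite gcommVg; apply: UJ; last exact/UV/(U_top Ux).
  by apply: UV; exact: Rx.
- exact: US.
- by move=> j u /Rx; rewrite addSn => /US.
- exact: Rx.
move=> k u Uu; have HW := gHall_Witt x y^-1 u; rewrite invgK in HW.
have Ry' v m : U m v -> U (j + m) [~ y^-1, v].
  move=> Uv; rewrite gcommVg; apply: UJ; last exact/UV/(U_top Uy).
  by apply: UV; exact: Ry.
have Rx' v m : U m v -> U (i + m) [~ x^-1, v].
  move=> Uv; rewrite gcommVg; apply: UJ; last exact/UV/(U_top Ux).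
  by apply: UV; exact: Rx.
have U2 : U (i + j + k) ([~ y^-1, u^-1, x] ^ u).
  apply: UJ (U_top Uu); rewrite -invgR -addnA; apply/UV/Rx/Ry'; exact: UV.
have U3 : U (i + j + k) ([~ u, x^-1, y^-1] ^ x).
  apply: UJ (U_top Ux); rewrite -invgR (addnC i) -addnA; apply/UV/Ry'.
  by rewrite -invgR; apply/UV/Rx'.
have -> : [~ x, y, u] = ([~ y^-1, u^-1, x] ^ u * [~ u, x^-1, y^-1] ^ x)^-1 ^ y.
  apply: (conjg_inj y^-1); rewrite -[RHS]conjgM mulgV conjg1.
  apply: (mulIg ([~ y^-1, u^-1, x] ^ u * [~ u, x^-1, y^-1] ^ x)).
  by rewrite mulVg mulgA.
by apply: UJ (U_top Uy); apply: UV; exact: UM.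
Qed.
End CentralChain.

(** * Finite groups of maximal class *)

Definition lcn_chain (gT : finGroupType) (G : {group gT}) k : set gT :=
  fun z => z \in 'L_k(G).

Lemma lcn_chain_filtration (gT : finGroupType) (G : {group gT}) :
  filtration (chain_filtration (lcn_chain G)).
Proof.
apply: chain_filtrationP; rewrite /lcn_chain /=.
- by move=> k; exact: group1.
- by move=> k x y; exact: groupM.
- by move=> k x; rewrite groupV.
- by move=> k x; apply: (subsetP (lcn_subS k G)).
- by [].
by move=> k x y Lx Gy; apply: (subsetP (lcnSnS _ _)); rewrite mem_commg.
Qed.

Lemma lcn_chain_top (gT : finGroupType) (G : {group gT}) x :
  x \in G -> chain_filtration (lcn_chain G) 1%N x.
Proof.
move=> Gx; apply: chain_filtration_top => //; rewrite /lcn_chain /=.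
  by move=> k y; rewrite groupV.
by move=> k y z Ly Gz; apply: (subsetP (lcnSnS _ _)); rewrite mem_commg.
Qed.

Lemma lcn_chain_trivial (gT : finGroupType) (G : {group gT}) c :
    nilpotent G -> nil_class G < c ->
  forall z, chain_filtration (lcn_chain G) c z -> z = 1.
Proof.
move=> nilG; case: c => // c /(lcn_nil_classP c nilG) Lc z [+ _].
by rewrite /lcn_chain Lc => /set1P.
Qed.

Lemma der1_ind (gT : finGroupType) (G : {group gT}) (P : gT -> Prop) :
    P 1 -> (forall x y, P x -> P y -> P (x * y)) ->
    (forall x y, x \in G -> y \in G -> P [~ x, y]) ->
  forall x, x \in G^`(1) -> P x.
Proof.
move=> P1 PM PR x G'x; pose D := [set y | `[< P y >]].
have gD : group_set D.
  apply/group_setP; split; first by rewrite inE; exact/asboolP.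
  by move=> u v; rewrite !inE => /asboolP Pu /asboolP Pv; apply/asboolP/PM.
suff /subsetP/(_ x G'x) : G^`(1) \subset Group gD by rewrite inE => /asboolP.
rewrite gen_subG; apply/subsetP => _ /imset2P[u v Gu Gv ->].
by rewrite inE; apply/asboolP/PR.
Qed.

(** A larger centre would leave a quotient too small for its nilpotency class. *)
Lemma maximal_class_center p n (gT : finGroupType) (G : {group gT}) :
    prime p -> #|G| = (p ^ n)%N -> nil_class G = n.-1 -> 2 < n ->
  #|'Z(G)| = p.
Proof.
move=> p_pr oG clG n_gt2.
have pG : p.-group G by rewrite /pgroup oG pnatX pnat_id.
have nilG := pgroup_nil pG.
have not_abG : ~~ abelian G by rewrite -nil_class1 clG -ltnNge ltn_predRL.
have p_gt1 := prime_gt1 p_pr.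
have [k oZ] := p_natP (pgroupS (center_sub G) pG).
have oGZ : #|G / 'Z(G)| = (p ^ (n - k))%N.
  rewrite card_quotient ?normal_norm ?center_normal // -divgS ?center_sub //.
  rewrite oG oZ expnB ?prime_gt0 // -(leq_exp2l _ _ p_gt1) -oG -oZ.
  exact/subset_leq_card/center_sub.
have k_gt0 : 0 < k.
  rewrite lt0n; apply: contra not_abG => /eqP k0.
  have: 'Z(G) == 1 by rewrite trivg_card1 oZ k0.
  by rewrite (center_nil_eq1 nilG) => /eqP->; exact: abelian1.
have := nil_class_pgroup (quotient_pgroup 'Z(G) pG).
rewrite nil_class_quotient_center // clG oGZ pfactorK //.
case: k k_gt0 oZ oGZ => // [[|k]] _ oZ oGZ; first by rewrite oZ expn1.
rewrite leq_max; case/orP => [|]; last by move: n_gt2; clear; lia.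
(* Only n = 3 is compatible with the class, and there the quotient is cyclic. *)
move=> n_le3; have n3 : n = 3 by move: n_gt2 n_le3; clear; lia.
case/negP: not_abG; apply: cyclic_center_factor_abelian.
have [k0|k_gt0] := posnP k; first by apply: prime_cyclic; rewrite oGZ n3 k0.
suff -> : G / 'Z(G) = 1 by exact: cyclic1.
by apply/eqP; rewrite trivg_card1 oGZ n3; case: k k_gt0 {oZ oGZ}.
Qed.

(** Induction on the order through Q = G / 'Z(G). For n > 3 both 'Z(G) and 'Z(Q)
have order p, the p-th power map is a homomorphism from Q to 'Z(Q), and
[~ y, g] ^+ p = 1 as soon as the image of y in Q lies in its kernel. *)
Lemma maximal_class_der1 p n (gT : finGroupType) (G : {group gT}) :
    prime p -> #|G| = (p ^ n)%N -> nil_class G = n.-1 -> n <= p.+1 ->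
  {in G^`(1), forall x, x ^+ p = 1}.
Proof.
move=> p_pr; elim: n gT G => [|n IHn] gT G oG clG le_np x G'x.
  have abG : abelian G by rewrite -nil_class1 clG.
  by move: G'x; rewrite (derG1P abG) => /set1P->; exact: expg1n.
have [n_le1|n_gt1] := leqP n 1.
  have abG : abelian G by rewrite -nil_class1 clG.
  by move: G'x; rewrite (derG1P abG) => /set1P->; exact: expg1n.
have pG : p.-group G by rewrite /pgroup oG pnatX pnat_id.
have nilG := pgroup_nil pG.
have oZ := maximal_class_center p_pr oG clG n_gt1.
have [n_le2|n_gt2] := leqP n 2.
  have /subsetP/(_ x G'x) : G^`(1) \subset 'Z(G) by rewrite -nil_class2 clG.
  by move/expg_cardG; rewrite oZ.
pose Q := (G / 'Z(G))%G.
have nilQ : nilpotent Q by exact: quotient_nil.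
have oQ : #|Q| = (p ^ n)%N.
  rewrite /= card_quotient ?normal_norm ?center_normal // -divgS ?center_sub //.
  by rewrite oG oZ expnS mulKn ?prime_gt0.
have clQ : nil_class Q = n.-1 by rewrite /= nil_class_quotient_center // clG.
have Q'p := IHn _ Q oQ clQ (ltnW le_np).
have oZQ := maximal_class_center p_pr oQ clQ n_gt2.
have fQ := lcn_chain_filtration Q.
have expQM a b : a \in Q -> b \in Q -> (a * b) ^+ p = a ^+ p * b ^+ p.
  move=> Qa Qb; apply: (filt_expgM fQ) => //; try exact: lcn_chain_top.
    by move=> z [L2z _]; exact: Q'p.
  apply: lcn_chain_trivial => //; rewrite clQ; move: n_gt2 le_np; clear; lia.
have expQZ a : a \in Q -> a ^+ p \in 'Z(Q).
  move=> Qa; apply/centerP; split; first exact: groupX.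
  move=> b Qb; apply/commgP/conjg_fixP.
  rewrite conjXg conjg_mulR expQM ?groupR //.
  by rewrite (Q'p [~ a, b]) ?mulg1 // mem_commg.
have GQ g : g \in G -> coset 'Z(G) g \in Q by exact: mem_quotient.
have nZ g : g \in G -> g \in 'N('Z(G)) by exact/subsetP/normal_norm/center_normal.
have fG := lcn_chain_filtration G.
have G1 : forall z, chain_filtration (lcn_chain G) p.+1 z -> z = 1.
  by apply: lcn_chain_trivial => //; rewrite clG.
have central_comm y g : y \in G -> g \in G -> coset 'Z(G) y ^+ p = 1 ->
    [~ y, g] ^+ p = 1.
  move=> Gy Gg yp.
  have Zyp : y ^+ p \in 'Z(G).
    by apply: coset_idr; rewrite ?nZ ?groupX // morphX ?nZ.
  apply: (regular_commg (prime_regular p_pr (leqnn p)) (prime_gt1 p_pr) fG G1);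
    try exact: lcn_chain_top.
  by move=> h [Gh _]; case/centerP: Zyp => _; apply.
have comm_p h g : h \in G -> g \in G -> [~ h, g] ^+ p = 1.
  move=> Gh Gg; have [hp|hp] := eqVneq (coset 'Z(G) h ^+ p) 1.
    exact: central_comm.
  have ZQh := expQZ _ (GQ h Gh); have ZQg := expQZ _ (GQ g Gg).
  have : 'Z(Q) \subset <[coset 'Z(G) h ^+ p]>.
    have ZQ_pr : prime #|'Z(Q)| by rewrite oZQ.
    case: (prime_subgroupVti <[coset 'Z(G) h ^+ p]> ZQ_pr) => // tiZ.
    case/eqP: hp; apply/set1P; rewrite -[[set 1]]/(1%g : {set _}) -tiZ.
    by rewrite inE cycle_id.
  (* Dividing g by a power of h moves it into the kernel of the p-th power map,
     and does not change the commutator with h up to conjugation. *)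
  move/subsetP/(_ _ ZQg)/cycleP => [k gk].
  pose m := g * h ^- k.
  have mp : coset 'Z(G) m ^+ p = 1.
    rewrite morphM ?nZ ?groupV ?groupX // morphV ?nZ ?groupX // morphX ?nZ //.
    rewrite expQM ?groupV ?groupX ?GQ // expVgn gk -!expgnA mulnC mulgV //.
  have Gm : m \in G by rewrite groupM ?groupV ?groupX.
  have -> : g = m * h ^+ k by rewrite mulgKV.
  rewrite commgMJ commgXg mul1g -conjXg -invgR expVgn central_comm //.
  by rewrite invg1 conj1g.
have [] // : chain_filtration (lcn_chain G) 2 x /\ x ^+ p = 1.
apply: (der1_ind (P := fun x =>
  chain_filtration (lcn_chain G) 2 x /\ x ^+ p = 1)) G'x.
- by split; [exact: filt1 | exact: expg1n].
- move=> u v [Au up] [Av vp]; split; first exact: (filtM fG).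
  apply: (expgp_eq1_mul p_pr fG) => // z Az; apply: G1; apply: (filt_leq fG _ Az).
  by rewrite -addnn -addn1 leq_add2l prime_gt0.
move=> h g Gh Gg; split; last exact: comm_p.
exact: (filtR fG (lcn_chain_top Gh) (lcn_chain_top Gg)).
Qed.

(** * Pairs of morphisms subject to the relations of nu(G) *)

Section CompatiblePairs.
Variables (G N : groupType).

(** Stating the relations for an abstract pair makes their symmetry in the two
factors available ([compatible_sym]). *)
Record compatible (b f : G -> N) : Prop := Compatible {
  compatMl : {morph b : x y / x * y};
  compatMr : {morph f : x y / x * y};
  compatJl : forall x y g, [~ b x, f y] ^ b g = [~ b (x ^ g), f (y ^ g)];
  compatJr : forall x y g, [~ b x, f y] ^ f g = [~ b (x ^ g), f (y ^ g)] }.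

Lemma compatible_sym b f : compatible b f -> compatible f b.
Proof.
case=> bM fM Jl Jr; split=> // x y g; rewrite -invgR conjVg ?Jl ?Jr invgR //.
Qed.

Section MultiplicativeMaps.
Variable f : G -> N.
Hypothesis fM : {morph f : x y / x * y}.

Lemma mulmorph1 : f 1 = 1.
Proof. by apply: (mulgI (f 1)); rewrite -fM !mulg1. Qed.
Lemma mulmorphV x : f x^-1 = (f x)^-1.
Proof. by apply: (mulgI (f x)); rewrite -fM !mulgV mulmorph1. Qed.
Lemma mulmorphR x y : f [~ x, y] = [~ f x, f y].
Proof. by rewrite !fM !mulmorphV. Qed.
Lemma mulmorphX x n : f (x ^+ n) = f x ^+ n.
Proof. by elim: n => [|n IHn]; rewrite ?mulmorph1 // !expgS fM IHn. Qed.
End MultiplicativeMaps.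

Variables b f : G -> N.
Hypothesis bf : compatible b f.
Let bM := compatMl bf.
Let fM := compatMr bf.

Lemma compat_conj_comm x y u v :
  [~ b u, f v] ^ [~ b x, f y] = [~ b u, f v] ^ b [~ x, y].
Proof.
have -> : [~ b x, f y] = b x^-1 * (f y^-1 * (b x * f y)).
  by rewrite commgEl conjgE (mulmorphV bM) (mulmorphV fM).
by rewrite !conjgM !(compatJl bf, compatJr bf) -!conjgM.
Qed.

(** Expanding [~ b x, f y * f z] in two ways, once after rewriting y * z as
z ^ y^-1 * y, computes the left-hand side; the right-hand side is computed from
b [~ x, y] = b x^-1 * b (x ^ y). *)
Lemma compat_commR x y z : [~ b x, f y, f z] = [~ b [~ x, y], f z].
Proof.
pose q := [~ b x, f y].
have yz : [~ b x, f z] * q ^ f z = q * [~ b x, f (z ^ y^-1)] ^ f y.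
  by rewrite -!gcommgMJ -!fM conjgE invgK !mulgA mulgVK.
have -> : [~ q, f z] = ([~ b x, f z]^-1) ^ q * [~ b x, f (z ^ y^-1)] ^ f y.
  by rewrite commgEl -[q ^ f z](mulKg [~ b x, f z]) yz [in RHS]conjgE !mulgA.
have -> : [~ b x, f (z ^ y^-1)] ^ f y = [~ b (x ^ y), f z].
  by rewrite (compatJr bf) -conjgM mulVg conjg1.
rewrite conjVg compat_conj_comm -conjVg.
have -> : b [~ x, y] = b x^-1 * b (x ^ y) by rewrite -bM -commgEl.
by rewrite gcommMgJ (mulmorphV bM) gcommVg -conjgM.
Qed.

Lemma compat_commL x y z : [~ b x, f y, b z] = [~ b [~ x, y], f z].
Proof. by rewrite -compat_commR !commgEl (compatJl bf) (compatJr bf). Qed.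

End CompatiblePairs.

(** By symmetry the left-hand side is [~ f x, b y, b z], and [~ f x, b y] is the
inverse of [~ b y, f x]; the inverses are absorbed because [~ f x, b y] and
b [~ x, y] act in the same way by conjugation. *)
Lemma compat_comm_swap (G N : groupType) (b f : G -> N) x y z :
  compatible b f -> [~ f [~ x, y], b z] = [~ b [~ x, y], f z].
Proof.
move=> bf; have fb := compatible_sym bf.
have bM := compatMl bf.
set w := [~ x, y].
have -> : [~ f w, b z] = ([~ b w, f z] ^ (b w)^-1) ^ [~ f x, b y].
  rewrite -(compat_commR fb) -[[~ f x, b y]]invgR gcommVg (compat_commL bf).
  by rewrite -[[~ y, x]]invgR (mulmorphV bM) gcommVg !conjVg invgK.
rewrite -(mulmorphV bM) (compatJl bf) -invgR conjVg (compat_conj_comm fb).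
by rewrite (compatJl fb) invgR -!conjgM mulVg !conjg1.
Qed.

(** * Generated subgroups *)

Section Generated.
Variables (T : groupType) (S : set T).

Lemma generated_mem x : S x -> generated S x.
Proof. by move=> Sx H [_ SH]; exact: SH. Qed.

Lemma generated1 : generated S 1.
Proof. by move=> H [[]]. Qed.

Lemma generatedM x y : generated S x -> generated S y -> generated S (x * y).
Proof.
move=> Sx Sy H HS; have [[_ HM _] _] := HS.
by apply: HM; apply/mem_set; [exact: Sx | exact: Sy].
Qed.

Lemma generatedV x : generated S x -> generated S x^-1.
Proof.
by move=> Sx H HS; have [[_ _ HV] _] := HS; apply: HV; apply/mem_set; exact: Sx.
Qed.

Lemma generated_ind (P : set T) : P 1 -> (forall x y, P x -> P y -> P (x * y)) ->
  (forall x, P x -> P x^-1) -> (forall x, S x -> P x) ->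
  forall x, generated S x -> P x.
Proof.
move=> P1 PM PV SP x; apply; split=> //.
split=> // [u v /set_mem Pu /set_mem Pv|u /set_mem Pu].
  exact: PM.
exact: PV.
Qed.
End Generated.

Lemma generated_sub (T : groupType) (R S : set T) x :
  (forall z, R z -> S z) -> generated R x -> generated S x.
Proof.
move=> RS; apply: generated_ind; first exact: generated1.
- exact: generatedM.
- exact: generatedV.
by move=> z /RS; exact: generated_mem.
Qed.

(** * The group nu(G) *)

Section NuPresentation.
Local Open Scope quotient_scope.
Variable G : groupType.
Local Notation pi := (\pi_(nu G)).

Lemma nu_piM : {morph (pi : freeprod G G -> nu G) : x y / x * y}.
Proof. by move=> x y; exact/esym/quo_mulE. Qed.

Lemma fp_inlM : {morph (@fp_inl G G) : x y / x * y}.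
Proof.
move=> x y; rewrite /fp_inl; apply/esym/(etrans (freeprod_mulE _ _)).
exact/freeprodP/word_eq_Ml.
Qed.

Lemma fp_inrM : {morph (@fp_inr G G) : x y / x * y}.
Proof.
move=> x y; rewrite /fp_inr; apply/esym/(etrans (freeprod_mulE _ _)).
exact/freeprodP/word_eq_Mr.
Qed.

Lemma nu_relator u v : nu_relators (u^-1 * v) -> pi u = pi v :> nu G.
Proof. by move=> Rr; apply/quoP => H [_]; exact. Qed.

Lemma nu_compatible : compatible (@nu_base G) (@nu_phi G).
Proof.
have piJ u v : pi (u ^ v) = pi u ^ pi v :> nu G.
  by rewrite !conjgE !nu_piM (mulmorphV nu_piM).
have piR := mulmorphR nu_piM.
split=> [x y|x y|x y g|x y g].
- by rewrite /nu_base fp_inlM nu_piM.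
- by rewrite /nu_phi fp_inrM nu_piM.
- rewrite /nu_base /nu_phi -!piR -piJ.
  by apply: nu_relator; exists x, y, g; left.
rewrite /nu_base /nu_phi -!piR -piJ.
by apply/esym/nu_relator; exists x, y, g; right.
Qed.

Lemma nu_ind (P : nu G -> Prop) : P 1 -> (forall x y, P x -> P y -> P (x * y)) ->
  (forall g, P (nu_base g)) -> (forall g, P (nu_phi g)) -> forall x, P x.
Proof.
move=> P1 PM Pb Pf x; elim/quotW: x => x; elim/quotW: x.
elim=> [|l w IHw]; first exact: P1.
have -> : \pi_(freeprod G G) (l :: w)
        = \pi_(freeprod G G) [:: l] * \pi_(freeprod G G) w.
  by apply/esym; exact: freeprod_mulE.
rewrite nu_piM; apply: PM => //; case: l => g; [exact: Pb | exact: Pf].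
Qed.
End NuPresentation.

Section NuChain.
Variable gT : finGroupType.
Local Notation G := [set: gT].
Local Notation b := (@nu_base gT).
Local Notation f := (@nu_phi gT).
Let bf := nu_compatible gT.
Let bM := compatMl bf.
Let fM := compatMr bf.

(** An upper bound for the lower central series of nu(G). Since 'L_0 and 'L_1 are
both the whole group, the terms 0 and 1 coincide with nu(G). *)
Definition nu_chain_gens k : set (nu gT) := fun z =>
  [\/ exists2 a, a \in 'L_k(G) & z = b a,
      exists2 a, a \in 'L_k(G) & z = f a
    | exists2 a, a \in 'L_k.-1(G) & exists g, z = [~ b a, f g]].

Definition nu_chain k := generated (nu_chain_gens k).

Lemma nu_chainS k x : nu_chain k.+1 x -> nu_chain k x.
Proof.
apply: generated_sub => z; rewrite /nu_chain_gens /=.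
case=> [[a La ->]|[a La ->]|[a La [g ->]]].
- by apply: Or31; exists a => //; exact: (subsetP (lcn_subS k _)).
- by apply: Or32; exists a => //; exact: (subsetP (lcn_subS k _)).
apply: Or33; exists a; last by exists g.
exact: (subsetP (lcn_sub_leq _ (leq_pred k))).
Qed.

Lemma nu_chain_base k a : a \in 'L_k(G) -> nu_chain k (b a).
Proof. by move=> La; apply: generated_mem; apply: Or31; exists a. Qed.

Lemma nu_chain_phi k a : a \in 'L_k(G) -> nu_chain k (f a).
Proof. by move=> La; apply: generated_mem; apply: Or32; exists a. Qed.

Lemma nu_chain_tensor k a h : a \in 'L_k(G) -> nu_chain k.+1 [~ b a, f h].
Proof.
by move=> La; apply: generated_mem; apply: Or33; exists a => //; exists h.
Qed.

Lemma nu_chain_all x : nu_chain 1%N x.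
Proof.
elim/nu_ind: x => [|x y|g|g].
- exact: generated1.
- exact: generatedM.
- by apply: nu_chain_base; exact: in_setT.
by apply: nu_chain_phi; exact: in_setT.
Qed.

Lemma der1_comm_swap a h : a \in G^`(1) -> [~ f a, b h] = [~ b a, f h].
Proof.
move=> G'a; move: a G'a h.
apply: (der1_ind (P := fun a => forall h, [~ f a, b h] = [~ b a, f h])).
- by move=> h; rewrite (mulmorph1 bM) (mulmorph1 fM) !comm1g.
- move=> u v Pu Pv h.
  by rewrite bM fM !gcommMgJ Pu Pv (compatJl bf) (compatJr bf).
by move=> u v _ _ h; exact: (compat_comm_swap _ _ _ bf).
Qed.

(** Commutators across the two factors are again of the form [~ b a, f h]: for
s = [~ b c, f h] by [compat_commL] and [compat_commR], and for f a
against b g by [der1_comm_swap], or by antisymmetry when 'L_k is the whole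
group. *)
Lemma nu_chain_gensR k s g : nu_chain_gens k s ->
  nu_chain k.+1 [~ s, b g] /\ nu_chain k.+1 [~ s, f g].
Proof.
have LR i a h : a \in 'L_i(G) -> [~ a, h] \in 'L_i.+1(G).
  by move=> La; apply: (subsetP (lcnSnS _ _)); rewrite mem_commg ?inE.
have Lpred a h : a \in 'L_k.-1(G) -> [~ a, h] \in 'L_k(G).
  by case: (k) => [|j] La; [exact: in_setT | exact: LR].
have tensor := @nu_chain_tensor k.
case=> [[a La ->]|[a La ->]|[a La [h ->]]]; split.
- by rewrite -(mulmorphR bM); apply: nu_chain_base; exact: LR.
- exact: tensor.
- have [k_le1|k_gt1] := leqP k 1.
    rewrite -invgR; apply: generatedV; apply: tensor => {Lpred La}.
    by case: k k_le1 => [|[|j]] // _; exact: in_setT.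
  rewrite der1_comm_swap; first exact: tensor.
  exact: (subsetP (lcn_sub_leq _ k_gt1)).
- by rewrite -(mulmorphR fM); apply: nu_chain_phi; exact: LR.
- rewrite (compat_commL bf); apply: tensor; exact: Lpred.
by rewrite (compat_commR bf); apply: tensor; exact: Lpred.
Qed.

Lemma nu_chainJ_gen k h :
    (forall s, nu_chain_gens k s -> nu_chain k.+1 [~ s, h]) ->
  forall x, nu_chain k x -> nu_chain k (x ^ h).
Proof.
move=> sR; apply: (generated_ind (P := fun x => nu_chain k (x ^ h))).
- by rewrite conj1g; exact: generated1.
- by move=> u v; rewrite conjMg; exact: generatedM.
- by move=> u; rewrite conjVg; exact: generatedV.
move=> u Su; rewrite gconjg_mulR; apply: generatedM; first exact: generated_mem.
by apply: nu_chainS; exact: sR.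
Qed.

Lemma nu_chainJ k x y : nu_chain k x -> nu_chain k (x ^ y).
Proof.
elim/nu_ind: y x => [x|y z IHy IHz x|g|g].
- by rewrite conjg1.
- by rewrite conjgM => /IHy/IHz.
- by apply: nu_chainJ_gen => s /(nu_chain_gensR g)[].
by apply: nu_chainJ_gen => s /(nu_chain_gensR g)[].
Qed.

Lemma nu_chainR_gen k h :
    (forall s, nu_chain_gens k s -> nu_chain k.+1 [~ s, h]) ->
  forall x, nu_chain k x -> nu_chain k.+1 [~ x, h].
Proof.
move=> sR; apply: (generated_ind (P := fun x => nu_chain k.+1 [~ x, h])) => //.
- by rewrite comm1g; exact: generated1.
- move=> u v Uu Uv; rewrite gcommMgJ; apply: generatedM => //; exact: nu_chainJ.
by move=> u Uu; rewrite gcommVg; apply: nu_chainJ; exact: generatedV.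
Qed.

Lemma nu_chainR k x y : nu_chain k x -> nu_chain k.+1 [~ x, y].
Proof.
elim/nu_ind: y x => [x _|y z Uy Uz x Ux|g|g].
- by rewrite commg1; exact: generated1.
- rewrite gcommgMJ; apply: generatedM; first exact: Uz.
  by apply: nu_chainJ; exact: Uy.
- by apply: nu_chainR_gen => s /(nu_chain_gensR g)[].
by apply: nu_chainR_gen => s /(nu_chain_gensR g)[].
Qed.

Lemma nu_chain_filtration : filtration (chain_filtration nu_chain).
Proof.
apply: chain_filtrationP.
- by move=> k; exact: generated1.
- by move=> k x y; exact: generatedM.
- by move=> k x; exact: generatedV.
- exact: nu_chainS.
- by [].
by move=> k x y Ux _; exact: nu_chainR.
Qed.

Lemma nu_chain_top x : chain_filtration nu_chain 1%N x.
Proof.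
apply: chain_filtration_top (nu_chain_all x).
- by move=> k y; exact: generatedV.
by move=> k y z Uy _; exact: nu_chainR.
Qed.

Lemma nu_chain_trivial c x : nilpotent G -> nil_class G < c ->
  chain_filtration nu_chain c.+1 x -> x = 1.
Proof.
case: c => // c nilG cl_lt [+ _].
have L1 m : c < m -> 'L_m(G) = 1.
  case: m => // m le_cm; apply/(lcn_nil_classP m nilG).
  exact: leq_trans cl_lt le_cm.
move: x; apply: (generated_ind (P := fun x => x = 1)) => //.
- by move=> u v -> ->; exact: mulg1.
- by move=> u ->; exact: invg1.
move=> u; case=> [[a La ->]|[a La ->]|[a La [g ->]]]; move: La;
  rewrite L1 // => /set1P->.
- exact: (mulmorph1 bM).
- exact: (mulmorph1 fM).
by rewrite (mulmorph1 bM) comm1g.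
Qed.

Lemma der1_filtration2 a : a \in G^`(1) -> chain_filtration nu_chain 2 (b a).
Proof.
have fW := nu_chain_filtration.
move: a; apply: (der1_ind (P := fun a => chain_filtration nu_chain 2 (b a))).
- by rewrite (mulmorph1 bM); exact: filt1.
- by move=> u v Wu Wv; rewrite bM; exact: (filtM fW).
move=> u v _ _; rewrite (mulmorphR bM).
exact: (filtR fW (nu_chain_top _) (nu_chain_top _)).
Qed.

(** A generator [~ b a, f g] is the product of (b a)^-1 and a conjugate of b a;
both are killed by p and lie in degree 2 of a filtration that vanishes in degree
p + 2, hence in degree 2p. *)
Lemma comm_phi_exp p i x : prime p -> nilpotent G -> nil_class G <= p -> 1 < i ->
    {in G^`(1), forall a, a ^+ p = 1} ->
  comm_phi_r 'L_i(G) G x -> x ^+ p = 1.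
Proof.
move=> p_pr nilG cl_p i_gt1 G'p.
have fW := nu_chain_filtration.
have W1 z : chain_filtration nu_chain p.*2 z -> z = 1.
  move=> Wz; apply: (@nu_chain_trivial p.+1) => //.
  by apply: (filt_leq fW _ Wz); rewrite -addnn -addn2 leq_add2l prime_gt1.
move=> Hx; suff [] : chain_filtration nu_chain 2 x /\ x ^+ p = 1 by [].
move: x Hx; apply: (generated_ind
  (P := fun x => chain_filtration nu_chain 2 x /\ x ^+ p = 1)) =>
  [|u v [Wu up] [Wv vp]|u [Wu up]|z].
- by split; [exact: filt1 | exact: expg1n].
- by split; [exact: (filtM fW) | exact: (expgp_eq1_mul p_pr fW W1)].
- by split; [exact: (filtV fW) | rewrite expVgn up invg1].
case=> _ [a /= La <-] [_ [g _ <-] <-].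
have G'a : a \in G^`(1) by exact: (subsetP (lcn_sub_leq _ i_gt1)).
have Wa := der1_filtration2 G'a.
have ap : b a ^+ p = 1 by rewrite -(mulmorphX bM) G'p // (mulmorph1 bM).
have W0 := filt0 fW (nu_chain_top (f g)).
rewrite commgEl; split.
  by apply: (filtM fW); [exact: (filtV fW) | exact: (filtJ fW Wa W0)].
apply: (expgp_eq1_mul p_pr fW W1).
- exact: (filtV fW).
- exact: (filtJ fW Wa W0).
- by rewrite expVgn ap invg1.
by rewrite -conjXg ap conj1g.
Qed.

Lemma comm_phi_sym i : 1 < i -> comm_phi_r 'L_i(G) G = comm_phi_l 'L_i(G) G.
Proof.
move=> i_gt1.
have swap a g : a \in 'L_i(G) -> [~ f a, b g] = [~ b a, f g].
  by move=> La; apply: der1_comm_swap; exact: (subsetP (lcn_sub_leq _ i_gt1)).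
apply/seteqP; split=> x; apply: generated_sub => _ [_ [a /= La <-] [_ [g Gg <-] <-]].
  by exists (f a); [exists a | exists (b g); [exists g | exact: swap]].
by exists (b a); [exists a | exists (f g); [exists g | rewrite -swap]].
Qed.

End NuChain.

Lemma has_exponent_le (T : groupType) (H : set T) p : 0 < p ->
  (forall h, H h -> h ^+ p = 1) -> exists2 e, has_exponent H e & e <= p.
Proof.
move=> p_gt0 Hp.
pose P e := `[< 0 < e /\ {in H, forall h, h ^+ e = 1} >].
have exP : exists e, P e.
  by exists p; apply/asboolP; split=> // h /set_mem; exact: Hp.
have [e /asboolP[e_gt0 He] e_min] := ex_minnP exP.
have minH m : 0 < m -> {in H, forall h, h ^+ m = 1} -> e <= m.
  by move=> m_gt0 Hm; apply: e_min; apply/asboolP.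
exists e; first by split.
by apply: minH => // h /set_mem; exact: Hp.
Qed.

Theorem theorem1 (p n : nat) (gT : finGroupType)
    (p_prime : prime p) (p_odd : odd p)
    (n_bounds : 4 <= n <= p + 1)
    (card_G : #|[set: gT]| = (p ^ n)%N)
    (nil_class_G : nil_class [set: gT] = (n - 1)%N)
    (exponent_G : exponent [set: gT] = (p ^ 2)%N) :
  forall i : nat, 2 <= i <= n - 1 ->
    comm_phi_r 'L_i([set: gT]) [set: gT]
      = comm_phi_l 'L_i([set: gT]) [set: gT]
    /\ exists2 e : nat,
         has_exponent (comm_phi_r 'L_i([set: gT]) [set: gT]) e & e <= p.
Proof.
move=> i /andP[i_gt1 _]; case/andP: n_bounds => _ n_le.
split; first exact: comm_phi_sym.
have pG : p.-group [set: gT] by rewrite /pgroup card_G pnatX pnat_id.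
apply: has_exponent_le (prime_gt0 p_prime) _ => x.
apply: comm_phi_exp => //.
- exact: pgroup_nil pG.
- by rewrite nil_class_G leq_subLR addnC.
apply: maximal_class_der1 card_G _ _ => //.
  by rewrite nil_class_G subn1.
by rewrite -addn1.
Qed.
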